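(* For every $f\in F(n)$ there exists a permutation $\sigma$ of $[n]$ that rearranges $f$ stably into an idempotent map $\iota\in I(n)$, i.e. $\iota(i)=f(\sigma(i))$ for $i=1,2,\ldots,n$; and such a $\sigma$ can be determined from $f$ (in an output array) in $\mathcal{O}(n)$ time using $2\log n$ bits.
   Context: $[n]=\{1,2,\ldots,n\}$. $F(n)$ is the set of all maps $f:[n]\to[n]$, and $I(n)\subseteq F(n)$ is the set of idempotent maps, i.e. those $\iota$ with $\iota(\iota(x))=\iota(x)$ for all $x\in[n]$. For $\iota\in I(n)$ and a fixed point $a$ of $\iota$, the index class of $a$ is $[a]_\iota=\{x\in[n]:\iota(x)=a\}$; $a\in[a]_\iota$ is its fixed index and the other members are its idle indices. ''Stably'' means that equal elements of $f$ keep their original order, where each class $[a]_\iota$ is read with the fixed index $a$ first, followed by its idle indices in increasing order: if $[a]_\iota$ is listed as $x_1=a$ followed by the idle indices $x_2<x_3<\cdots$, then $\sigma(x_1)<\sigma(x_2)<\sigma(x_3)<\cdots$. $f$ is stored in an array $D[1\ldots n]$ and $\sigma$ is written to an output array $E[1\ldots n]$. Computation is on a unit-cost random access machine; ''$2\log n$ bits'' means that besides these two arrays 2 auxiliary variables of $\log n$ bits each (indices or values of magnitude $O(n)$) are used. *)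

(* Defs.v *)
From mathcomp Require Import all_boot all_fingroup.
Set Implicit Arguments.
Unset Strict Implicit.
Unset Printing Implicit Defensive.

(* The set {1, ..., n} is rendered by 'I_n, the element i : 'I_n standing for
   the number i.+1. *)

Definition index_class n (iota : {ffun 'I_n -> 'I_n}) (a : 'I_n) : {set 'I_n} :=
  [set x | iota x == a].

(* [enum] lists the ordinals in increasing order. *)
Definition class_listing n (iota : {ffun 'I_n -> 'I_n}) (a : 'I_n) : seq 'I_n :=
  a :: enum (index_class iota a :\ a).

Definition rearranges_stably n (f : {ffun 'I_n -> 'I_n}) (sigma : {perm 'I_n})
    (iota : {ffun 'I_n -> 'I_n}) : Prop :=
  [/\ idempotent_fun iota,
      forall i, iota i = f (sigma i)
    & forall a, iota a = a ->
        sorted (fun x y : 'I_n => sigma x < sigma y) (class_listing iota a)].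

(* Unit-cost random access machine.  The memory consists of an input array
   D[1..n] (never written), an output array E[1..n] (readable and writable) and
   two auxiliary variables X and Y.  An array cell is addressed by an auxiliary
   variable only, so that no operand needs hidden storage for an intermediate
   value. *)

Inductive aux := X | Y.

Inductive operand :=
  | Const of nat
  | Len            (* the length n of the arrays *)
  | Var of aux
  | D_at of aux
  | E_at of aux.

Inductive target := ToVar of aux | ToE of aux.

Inductive instr :=
  | Move of target & operand
  | Plus of target & operand & operand
  | Minus of target & operand & operand      (* truncated at 0 *)
  | JumpLt of operand & operand & nat
  | JumpEq of operand & operand & nat.

Definition program := seq instr.

Record state := State {
  pc : nat;
  var : aux -> nat;
  E : nat -> nat     (* only the cells 1..n are accessible *)
}.

Section Semantics.

Variables (n W : nat) (D : nat -> nat).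

(* [None] is a fault: address outside 1..n, or storing a value above W. *)

Definition cell (A : nat -> nat) (k : nat) : option nat :=
  if 0 < k <= n then Some (A k) else None.

Definition value (s : state) (o : operand) : option nat :=
  match o with
  | Const k => Some k
  | Len => Some n
  | Var r => Some (var s r)
  | D_at r => cell D (var s r)
  | E_at r => cell (E s) (var s r)
  end.

Definition upd_var (v : aux -> nat) (r : aux) (w : nat) : aux -> nat :=
  fun r' => match r, r' with X, X | Y, Y => w | _, _ => v r' end.

Definition upd_cell (A : nat -> nat) (k w : nat) : nat -> nat :=
  fun k' => if k' == k then w else A k'.

Definition store (s : state) (t : target) (w : nat) : option state :=
  if w <= W then
    match t with
    | ToVar r => Some (State (pc s).+1 (upd_var (var s) r w) (E s))
    | ToE r =>
        if 0 < var s r <= n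
        then Some (State (pc s).+1 (var s) (upd_cell (E s) (var s r) w))
        else None
    end
  else None.

Definition jump (s : state) (b : bool) (l : nat) : state :=
  State (if b then l else (pc s).+1) (var s) (E s).

Definition exec (i : instr) (s : state) : option state :=
  match i with
  | Move t a =>
      if value s a is Some u then store s t u else None
  | Plus t a b =>
      if (value s a, value s b) is (Some u, Some v)
      then store s t (u + v) else None
  | Minus t a b =>
      if (value s a, value s b) is (Some u, Some v)
      then store s t (u - v) else None
  | JumpLt a b l =>
      if (value s a, value s b) is (Some u, Some v)
      then Some (jump s (u < v) l) else None
  | JumpEq a b l =>
      if (value s a, value s b) is (Some u, Some v)
      then Some (jump s (u == v) l) else None
  end.

Definition step (P : program) (s : state) : option state :=
  if onth P (pc s) is Some i then exec i s else None.

Definition steps (P : program) (t : nat) (s : state) : option state :=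
  iter t (obind (step P)) (Some s).

(* The variables and E may hold arbitrary words when the program starts. *)
Definition initial (s : state) : Prop :=
  [/\ pc s = 0, forall r, var s r <= W
    & forall k, 0 < k <= n -> E s k <= W].

Definition halted (P : program) (s : state) : Prop := pc s = size P.

End Semantics.

Definition holds n (A : nat -> nat) (g : 'I_n -> 'I_n) : Prop :=
  forall i : 'I_n, A i.+1 = (g i).+1.

(* The bound c * n.+1 is both the time bound and the word size, i.e. two
   variables of log n + O(1) bits.  It uses n.+1 instead of n only in order to
   make sense for n = 0. *)
Definition determines (P : program) (c n : nat) (f sigma : 'I_n -> 'I_n) : Prop :=
  forall (D : nat -> nat) (s : state),
    holds D f -> initial n (c * n.+1) s ->
    exists t s',
      [/\ t <= c * n.+1, steps n (c * n.+1) D P t s = Some s',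
          halted P s' & holds (E s') sigma].

(* Main.v *)
(** Let [sigma] send every value of [f] to its earliest occurrence, and let it map
the indices missed by [f] increasingly onto the indices that repeat an earlier
value; there are equally many of both.  Stability within a class is then
monotonicity of this bijection.  One downward scan [E[D[i]] := i] leaves in [E] the
earliest occurrence of each value and 0 at the missed indices.  A second
downward scan moves [X] over the missed indices and [Y] over the repeats.  To
decide whether [Y] is a repeat one has to inspect [E[D[Y]]], which seems to need
a third variable; but the missed cell [E[X]] is still free and can hold [Y]
while [Y] itself is overwritten by [D[Y]]. *)

Require Import Defs.
From mathcomp Require Import all_boot all_fingroup.
From mathcomp Require Import zify.
Set Implicit Arguments.
Unset Strict Implicit.
Unset Printing Implicit Defensive.

(** * Ranks of indices within a set *)

Section Rank.

Variable n : nat.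
Implicit Types (A : {set 'I_n}) (x y : 'I_n).

Definition rank A (k : nat) : nat := #|[set z in A | z < k]|.

Lemma rank0 A : rank A 0 = 0.
Proof. by apply/eqP; rewrite cards_eq0; apply/eqP/setP => z; rewrite !inE ltn0 andbF. Qed.

Lemma rankS A x : rank A x.+1 = (x \in A) + rank A x.
Proof.
rewrite /rank (cardsD1 x) inE ltnSn andbT; congr (_ + _).
apply: eq_card => z; rewrite !inE ltnS [in RHS]ltn_neqAle -val_eqE.
by rewrite andbCA.
Qed.

Lemma rank_full A : rank A n = #|A|.
Proof. by apply: eq_card => z; rewrite inE ltn_ord andbT. Qed.

Lemma leq_rank A k l : k <= l -> rank A k <= rank A l.
Proof.
move=> kl; apply/subset_leq_card/subsetP => z; rewrite !inE => /andP[-> zk].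
exact: leq_trans zk kl.
Qed.

Lemma ltn_rank A x k : x \in A -> x < k -> rank A x < rank A k.
Proof. by move=> xA xk; rewrite (leq_trans _ (leq_rank A xk))// rankS xA. Qed.

Lemma rank_inj A : {in A &, injective (fun x => rank A x)}.
Proof.
move=> x y xA yA /= rxy; apply: val_inj; case: (ltngtP (val x) (val y)) => // lt.
- by have := ltn_rank xA lt; rewrite rxy ltnn.
- by have := ltn_rank yA lt; rewrite rxy ltnn.
Qed.

Lemma rank_lt A x y : x \in A -> y \in A -> (rank A x < rank A y) = (x < y).
Proof.
move=> xA yA; case: (ltnP x y) => [|/leq_rank]; first exact: ltn_rank.
by rewrite ltnNge => /(_ A) ->.
Qed.

(** Discrete intermediate values: [rank A] starts at 0, ends at [#|A|] and grows by at most 1 per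
    step. *)
Lemma rank_onto A r : r < #|A| -> exists2 x, x \in A & rank A x = r.
Proof.
rewrite -(rank_full A).
suff: forall k, k <= n -> r < rank A k -> exists2 x, x \in A & rank A x = r by apply.
elim=> [|k IH] kn; first by rewrite rank0.
rewrite -[k]/(val (Ordinal kn)) rankS; case: (boolP (_ \in A)) => kA /=; last first.
  by apply: IH; lia.
rewrite ltnS leq_eqVlt => /orP[/eqP->|]; first by exists (Ordinal kn).
by apply: IH; lia.
Qed.

End Rank.

(** * The permutation and its stability *)

Section Rearrangement.

Variables (n : nat) (f : {ffun 'I_n -> 'I_n}).

Definition earliest (y : 'I_n) : 'I_n := [arg min_(z < y | f z == f y) val z].

Lemma f_earliest y : f (earliest y) = f y.
Proof. by rewrite /earliest; case: arg_minnP => // z /eqP. Qed.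

Lemma earliest_le y z : f y = f z -> earliest y <= z.
Proof.
by rewrite /earliest => fyz; case: arg_minnP => // t _; apply; rewrite fyz.
Qed.

Lemma eq_earliest y z : f y = f z -> earliest y = earliest z.
Proof.
by move=> fyz; apply/val_inj/anti_leq; rewrite !earliest_le// f_earliest.
Qed.

Lemma earliest_idem y : earliest (earliest y) = earliest y.
Proof. exact/eq_earliest/f_earliest. Qed.

Definition repeats : {set 'I_n} := [set y | earliest y != y].
Definition missed : {set 'I_n} := ~: [set f y | y in 'I_n].

Lemma image_notin_missed y : f y \notin missed.
Proof. by rewrite inE negbK imset_f. Qed.

Lemma earliest_notin_repeats y : earliest y \notin repeats.
Proof. by rewrite inE negbK earliest_idem. Qed.

Lemma notin_missed x : x \notin missed -> exists y, x = f y.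
Proof. by rewrite inE negbK => /imsetP[y _ ->]; exists y. Qed.

(** Outside [repeats], [f] is injective and still attains its whole image, so the two complements
    have equal size. *)
Lemma card_missed : #|missed| = #|repeats|.
Proof.
have -> : missed = ~: [set f y | y in ~: repeats].
  congr (~: _); apply/setP => x; apply/imsetP/imsetP => -[y _ ->]; last by exists y.
  by exists (earliest y); rewrite ?f_earliest// inE earliest_notin_repeats.
apply: (@addnI #|~: repeats|); rewrite [RHS]addnC cardsC.
rewrite -(cardsC [set f y | y in ~: repeats]) card_in_imset // => y z.
by rewrite !inE !negbK => /eqP<- /eqP<-; rewrite !f_earliest => /eq_earliest.
Qed.

Definition greedy (x : 'I_n) : 'I_n :=
  if [pick y | f y == x] is Some y then earliest y
  else odflt x [pick y in repeats | rank repeats y == rank missed x].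

Lemma greedy_image y : greedy (f y) = earliest y.
Proof.
rewrite /greedy; case: pickP => [z /eqP/eq_earliest//|/(_ y)].
by rewrite eqxx.
Qed.

(* The default values of [greedy] are never used. *)
Lemma greedy_missed x : x \in missed ->
  greedy x \in repeats /\ rank repeats (greedy x) = rank missed x.
Proof.
move=> xN; rewrite /greedy; case: pickP => [z /eqP fz|_].
  by move: xN; rewrite -fz (negbTE (image_notin_missed z)).
case: pickP => [y /andP[yS /eqP->]//|none].
have [y yS ry] : exists2 y, y \in repeats & rank repeats y = rank missed x.
  by apply: rank_onto; rewrite -card_missed -rank_full; apply: ltn_rank.
by have := none y; rewrite yS ry eqxx.
Qed.

(** Values of [f] go to earliest occurrences, missed indices to repeats. These are disjoint, so only
    collisions within one kind have to be excluded. *)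
Lemma greedy_inj : injective greedy.
Proof.
move=> x y; case: (boolP (x \in missed)) => [xN|/notin_missed[x' ->]];
  case: (boolP (y \in missed)) => [yN|/notin_missed[y' ->]].
- have [_ rx] := greedy_missed xN; have [_ ry] := greedy_missed yN.
  by move=> eq_xy; apply: (rank_inj xN yN); rewrite -rx -ry eq_xy.
- have [xS _] := greedy_missed xN.
  by rewrite greedy_image => eq_xy; move: (earliest_notin_repeats y'); rewrite -eq_xy xS.
- have [yS _] := greedy_missed yN.
  by rewrite greedy_image => eq_xy; move: (earliest_notin_repeats x'); rewrite eq_xy yS.
- by rewrite !greedy_image => /(congr1 f); rewrite !f_earliest.
Qed.

Definition greedy_perm : {perm 'I_n} := perm greedy_inj.
Definition idempotent_rearrangement : {ffun 'I_n -> 'I_n} := [ffun x => f (greedy x)].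

Lemma greedy_mono x y : x \in missed -> y \in missed -> x < y -> greedy x < greedy y.
Proof.
move=> xN yN; have [xS rx] := greedy_missed xN; have [yS ry] := greedy_missed yN.
by rewrite -(rank_lt xN yN) -rx -ry rank_lt.
Qed.

(** By [greedy_image] the rearranged map fixes every value of [f], so idle indices are missed ones,
    and there [greedy] is increasing. *)
Lemma greedy_stable : rearranges_stably f greedy_perm idempotent_rearrangement.
Proof.
split=> [x | x | a]; first by rewrite /= !ffunE greedy_image f_earliest.
  by rewrite !ffunE permE.
rewrite ffunE => fa.
have tr : transitive (fun x y : 'I_n => greedy_perm x < greedy_perm y).
  by move=> y x z; apply: ltn_trans.
have idleN x : x \in index_class idempotent_rearrangement a :\ a -> x \in missed.
  rewrite !inE ffunE => /andP[xa /eqP fx]; apply: contraNN xa => /imsetP[y _ xE].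
  by move: fx; rewrite xE greedy_image f_earliest => ->.
rewrite /class_listing /= path_sortedE//; apply/andP; split.
  (* The fixed index goes to the earliest occurrence of [a], an idle index to a repeat of [a], hence
     strictly later. *)
  apply/allP => x; rewrite mem_enum => xI; rewrite !permE.
  have [xS _] := greedy_missed (idleN _ xI).
  have fx : f (greedy x) = a by move: xI; rewrite !inE ffunE => /andP[_ /eqP].
  rewrite -fx greedy_image ltn_neqAle earliest_le// andbT.
  by move: xS; rewrite inE.
apply: (@sub_in_sorted _ (mem missed) (fun x y : 'I_n => x < y)).
- by move=> x y xN yN xy; rewrite !permE greedy_mono.
- by apply/allP => x; rewrite mem_enum => /idleN.
- rewrite {1}/enum_mem; apply: sorted_filter; first by move=> y x z; apply: ltn_trans.
  rewrite -enumT -(@sorted_map _ _ (@nat_of_ord n) ltn) val_enum_ord.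
  exact: iota_ltn_sorted.
Qed.

End Rearrangement.

(** * The machine program *)

Notation goto l := (JumpEq (Const 0) (Const 0) l).

(* The phases start at 0 (clear [E]), 5 (earliest occurrences) and 11 (the
   missed cells).  Between 16 and 21, [E[X]] holds the value of [Y]. *)
Definition rearrange : program :=
  [:: (* 0 *) Move (ToVar X) Len;
      (* 1 *) JumpEq (Var X) (Const 0) 5;
      (* 2 *) Move (ToE X) (Const 0);
      (* 3 *) Minus (ToVar X) (Var X) (Const 1);
      (* 4 *) goto 1;
      (* 5 *) Move (ToVar X) Len;
      (* 6 *) JumpEq (Var X) (Const 0) 11;
      (* 7 *) Move (ToVar Y) (D_at X);
      (* 8 *) Move (ToE Y) (Var X);
      (* 9 *) Minus (ToVar X) (Var X) (Const 1);
      (* 10 *) goto 6;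
      (* 11 *) Move (ToVar X) Len;
      (* 12 *) Plus (ToVar Y) Len (Const 1);
      (* 13 *) JumpEq (Var X) (Const 0) 24;
      (* 14 *) JumpLt (Const 0) (E_at X) 22;
      (* 15 *) Minus (ToVar Y) (Var Y) (Const 1);
      (* 16 *) Move (ToE X) (Var Y);
      (* 17 *) Move (ToVar Y) (D_at Y);
      (* 18 *) JumpLt (E_at Y) (E_at X) 21;
      (* 19 *) Move (ToVar Y) (E_at X);
      (* 20 *) goto 15;
      (* 21 *) Move (ToVar Y) (E_at X);
      (* 22 *) Minus (ToVar X) (Var X) (Const 1);
      (* 23 *) goto 13].

(** * Correctness and running time of the program *)

Section Run.

Variables (n W : nat) (f : {ffun 'I_n -> 'I_n}) (D : nat -> nat).
Hypothesis (nW : n < W) (Df : holds D f).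
Implicit Types (v : aux -> nat) (A : nat -> nat) (Q : state -> Prop).

Definition runs (t : nat) (s : state) Q : Prop :=
  exists t' s', [/\ t' <= t, steps n W D rearrange t' s = Some s' & Q s'].

Lemma runs_stop t s Q : Q s -> runs t s Q.
Proof. by exists 0, s. Qed.

(** A fault turns the premise into [False], so symbolic execution also checks addresses and word
    sizes. *)
Lemma runs_step t s Q :
  oapp (fun s' => runs t s' Q) False (step n W D rearrange s) -> runs t.+1 s Q.
Proof.
case s1E: (step n W D rearrange s) => [s1|] //= [t' [s' [t't run Qs']]].
by exists t'.+1, s'; split; rewrite // /steps iterSr /= s1E.
Qed.

Lemma runs_leq t u s Q : t <= u -> runs t s Q -> runs u s Q.
Proof.
by move=> tu [t' [s' [t't ? ?]]]; exists t', s'; split=> //; apply: leq_trans tu.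
Qed.

Lemma runs_bind t u s Q Q' :
  runs t s Q -> (forall s', Q s' -> runs u s' Q') -> runs (t + u) s Q'.
Proof.
move=> [t' [s' [t't run Qs']]] /(_ _ Qs')[u' [s'' [u'u run' Q's'']]].
exists (u' + t'), s''; split=> //; first by rewrite addnC leq_add.
by move: run'; rewrite /steps iterD -run.
Qed.

Let leW k : k <= n -> k <= W.
Proof. by move/leq_trans; apply; apply: ltnW. Qed.

Ltac run_step := apply: runs_step; rewrite /step /= /store /cell /jump /=.

Lemma clear_loop x v A : x <= n -> v X = x -> (forall k, x < k <= n -> A k = 0) ->
  runs (4 * x).+1 (State 1 v A) (fun s => pc s = 5 /\ forall k, 0 < k <= n -> E s k = 0).
Proof.
elim: x v A => [|x IH] v A xn vX A0.
  by run_step; rewrite vX; apply: runs_stop.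
rewrite mulnS !addSn.
run_step; rewrite vX /=.
run_step; rewrite vX xn /=.
run_step; rewrite vX subn1 leW 1?ltnW //=.
run_step; apply: IH; rewrite 1?ltnW // => k xk.
by rewrite /upd_cell; case: eqP => // kx; apply: A0; lia.
Qed.

(* State of the first scan when the positions [x+1..n] have been read, that is,
   the ordinals [>= x]. *)
Definition earliest_from x A :=
  (forall z : 'I_n, x <= z -> 0 < A (f z).+1 <= z.+1) /\
  (forall a : 'I_n, 0 < A a.+1 -> exists2 z : 'I_n, A a.+1 = z.+1 & f z = a).

Lemma scan_loop x v A : x <= n -> v X = x -> earliest_from x A ->
  runs (5 * x).+1 (State 6 v A) (fun s => pc s = 11 /\ earliest_from 0 (E s)).
Proof.
elim: x v A => [|x IH] v A xn vX Ax.
  by run_step; rewrite vX; apply: runs_stop.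
have Dx := Df (Ordinal xn); set a := f _ in Dx; rewrite /= in Dx.
have an : a.+1 <= n := ltn_ord a.
rewrite mulnS !addSn.
run_step; rewrite vX /=.
run_step; rewrite vX xn /= Dx leW //=.
run_step; rewrite vX an leW //=.
run_step; rewrite vX subn1 leW 1?ltnW //=.
run_step; apply: IH; rewrite 1?ltnW //.
(* Overwriting a cell keeps the upper bounds, since the new content [x.+1] belongs to the smallest
   position read so far. *)
have [Ax1 Ax2] := Ax; split=> [z xz|b]; rewrite /upd_cell eqSS; case: eqP => [ba|ba].
- by rewrite ltnS.
- apply: Ax1; rewrite ltn_neqAle xz andbT; apply: contra_not_neq ba => xE.
  by congr (val (f _)); apply: val_inj.
- by exists (Ordinal xn) => //; apply: val_inj.
- exact: Ax2.
Qed.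

(** The missed cells below [x] still hold 0, the mark tested by instruction 14; for [x = n] none is
    filled. *)
Definition greedy_from x A :=
  forall k : 'I_n, A k.+1 = if (k \notin missed f) || (x <= k) then (greedy f k).+1 else 0.

Lemma earliest_greedy A : earliest_from 0 A -> greedy_from n A.
Proof.
move=> [A1 A2] a; rewrite leqNgt ltn_ord orbF.
case: (boolP (a \in missed f)) => [aN|/notin_missed[y ->]] /=.
  case: (posnP (A a.+1)) => // /A2[z _ fz].
  by move: (image_notin_missed f z); rewrite fz aN.
(* The stored position is an occurrence and a lower bound of all occurrences, so it is the earliest
   one. *)
have /andP[/A2[z Az fz] _] := A1 y isT.
have /andP[_] := A1 (earliest f y) isT; rewrite f_earliest Az greedy_image ltnS => zy.
by congr _.+1; apply/anti_leq; rewrite zy earliest_le.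
Qed.

Definition done s := halted rearrange s /\ greedy_from 0 (E s).

(* The time bound of the rest of the run is a linear potential in [X] and [Y]:
   each failed test lowers [Y], so the inner loop is amortized.  [Y = y.+1] means that
   the ordinals [>= y] have been used up, and the ranks say that as many
   repeats remain below [y] as there are missed cells left to fill. *)
Lemma missed_loop t x y v A (xn : x < n) : v X = x.+1 -> v Y = y.+1 -> y <= n ->
  Ordinal xn \in missed f -> rank (repeats f) y = rank (missed f) x.+1 ->
  (forall k : 'I_n, k != x :> nat ->
     A k.+1 = if (k \notin missed f) || (x < k) then (greedy f k).+1 else 0) ->
  (forall z v' A', v' X = x -> v' Y = z.+1 -> z <= n ->
     rank (repeats f) z = rank (missed f) x -> greedy_from x A' ->
     runs (t + 6 * z) (State 13 v' A') done) ->
  runs (t + 6 * y + 1) (State 15 v A) done.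
Proof.
have rx := rankS (missed f) (Ordinal xn); rewrite /= in rx.
elim: y v A => [|y IH] v A vX vY yn xN ry Ax next.
  by move: ry; rewrite rx xN rank0.
have Dy := Df (Ordinal yn); set a := f _ in Dy; rewrite /= in Dy.
have an : a.+1 <= n := ltn_ord a.
have aN : a \notin missed f by apply: image_notin_missed.
(* Parking [Y] in the missed cell [E[X]] cannot disturb [E[D[Y]]], whose address is a value of
   [f]. *)
have ax : (a.+1 == x.+1) = false.
  apply/negbTE; apply: contraNneq aN => -[ax].
  by rewrite (_ : a = Ordinal xn) //; apply: val_inj.
have Aa : A a.+1 = (earliest f (Ordinal yn)).+1.
  by rewrite Ax ?aN ?greedy_image // -eqSS ax.
have rS := rankS (repeats f) (Ordinal yn); rewrite /= in rS.
have ley : earliest f (Ordinal yn) <= y := @earliest_le _ f (Ordinal yn) _ erefl.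
have lt_y : (earliest f (Ordinal yn) < y) = (Ordinal yn \in repeats f).
  by rewrite inE ltn_neqAle ley andbT.
(* A failed test takes 6 steps, back to instruction 15; a successful one takes 7, up to instruction
   13. *)
rewrite (_ : t + 6 * y.+1 + 1 = 7 + (t + 6 * y)); last by lia.
rewrite !addSn add0n.
run_step; rewrite vY subn1 leW //=.
run_step; rewrite vX xn leW //=.
run_step; rewrite yn /= Dy leW //=.
run_step; rewrite vX xn an /upd_cell eqxx ax Aa /= ltnS lt_y.
case: ifP => yS; run_step; rewrite vX xn /= eqxx leW //=; last first.
  run_step; rewrite -addn1; apply: IH => // [||k kx]; first exact: ltnW.
    by rewrite -ry rS yS.
  by rewrite eqSS (negbTE kx) Ax.
run_step; rewrite vX subn1 leW 1?ltnW //=.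
have yx : rank (repeats f) y = rank (missed f) x.
  by apply/eqP; rewrite -(eqn_add2l 1); move: ry; rewrite rx rS xN yS => ->.
run_step; apply: next; rewrite // 1?ltnW // => k; rewrite eqSS.
case: eqP => [kx|/eqP kx]; last by rewrite Ax // [x <= k]leq_eqVlt eq_sym (negbTE kx).
have -> : k = Ordinal xn by apply: val_inj.
(* The parked value is already the final one: the repeat found has the rank that characterizes
   [greedy]. *)
rewrite /= leqnn orbT; have [gS rg] := greedy_missed xN.
by have <- : Ordinal yn = greedy f (Ordinal xn) by apply: (rank_inj yS gS); rewrite rg.
Qed.

Lemma fill_loop x y v A : v X = x -> v Y = y.+1 -> x <= n -> y <= n ->
  rank (repeats f) y = rank (missed f) x -> greedy_from x A ->
  runs (4 * x + 1 + 6 * y) (State 13 v A) done.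
Proof.
elim: x y v A => [|x IH] y v A vX vY xn yn ryx Ax.
  by run_step; rewrite vX; apply: runs_stop.
have rx := rankS (missed f) (Ordinal xn); rewrite /= in rx.
have Axx := Ax (Ordinal xn); rewrite ltnn orbF /= in Axx.
rewrite mulnS !addSn add0n.
run_step; rewrite vX /=.
run_step; rewrite vX xn /= Axx; case: (boolP (_ \in _)) => xN /=.
  apply: (runs_leq _ (missed_loop (t := 4 * x + 1) vX vY yn xN ryx _ _)).
  - by rewrite addn1.
  - by move=> k kx; rewrite Ax [x < k]ltn_neqAle eq_sym kx.
  - by move=> z v' A' vX' vY' zn rz Ax'; apply: IH => //; apply: ltnW.
run_step; rewrite vX subn1 leW 1?ltnW //=.
run_step; apply: IH => // [||k]; [exact: ltnW | by rewrite ryx rx (negbTE xN) |].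
rewrite Ax [x <= k]leq_eqVlt; case: eqP => //= xk; rewrite orbT.
by rewrite (_ : k = Ordinal xn) ?xN //; apply: val_inj.
Qed.

Lemma rearrange_spec s : pc s = 0 ->
  runs (24 * n.+1) s (fun s' => halted rearrange s' /\ holds (E s') (greedy f)).
Proof.
case: s => p v A /= ->.
(* One summand per phase, including its setup; the total is [19 * n + 7]. *)
apply: (@runs_leq ((4 * n).+2 + ((5 * n).+2 + (4 * n + 1 + 6 * n).+2))); first by lia.
rewrite addSn; run_step; rewrite leW //=.
apply: (runs_bind (clear_loop (leqnn n) _ _)) => // [k|[p1 v1 A1] /= [-> A10]].
  by lia.
rewrite addSn; run_step; rewrite leW //=.
apply: (runs_bind (scan_loop (leqnn n) _ _)) => // [|[p2 v2 A2] /= [-> A2P]].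
  split=> [z|a]; first by rewrite leqNgt ltn_ord.
  by rewrite A10 // ltnS ltn_ord.
run_step; rewrite leW //=.
(* The initial [Y], one past the array, is the only stored word exceeding [n]. *)
run_step; rewrite (addn1 n) nW /=.
have [|t' [s' [tn run [hs gA]]]] := @fill_loop n n (upd_var (upd_var v2 X n) Y n.+1) A2
  erefl erefl (leqnn n) (leqnn n) _ (earliest_greedy A2P); first by rewrite !rank_full card_missed.
by exists t', s'; split=> //; split=> // k; rewrite gA orbT.
Qed.

End Run.

Theorem theorem2p7 :
  (forall (n : nat) (f : {ffun 'I_n -> 'I_n}),
     exists (sigma : {perm 'I_n}) (iota : {ffun 'I_n -> 'I_n}),
       rearranges_stably f sigma iota)
  /\
  (exists (P : program) (c : nat),
     forall (n : nat) (f : {ffun 'I_n -> 'I_n}),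
       exists (sigma : {perm 'I_n}) (iota : {ffun 'I_n -> 'I_n}),
         rearranges_stably f sigma iota /\ determines P c f sigma).
Proof.
split=> [n f|].
  by exists (greedy_perm f), (idempotent_rearrangement f); apply: greedy_stable.
exists rearrange, 24 => n f.
exists (greedy_perm f), (idempotent_rearrangement f); split; first exact: greedy_stable.
move=> D s Df [pc0 _ _].
have nW : n < 24 * n.+1 by lia.
have [t [s' [ts run [hs Es]]]] := rearrange_spec nW Df pc0.
by exists t, s'; split=> // k; rewrite permE Es.
Qed.
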